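(* Let $\mathcal{A}$ be a Banach algebra and let $n$ be a natural number ($n\geq 1$). Suppose that $\mathcal{A}$ is approximately $(n+2)$-weakly amenable. Then $\mathcal{A}$ is approximately $n$-weakly amenable.
   Context: For $k\ge 1$, $\mathcal{A}^{(k)}$ is the $k$-th conjugate (iterated dual) space of $\mathcal{A}$ ($\mathcal{A}^{(0)}=\mathcal{A}$). It is a Banach $\mathcal{A}$-bimodule with actions defined inductively by $\langle u,\Lambda\cdot a\rangle=\langle a\cdot u,\Lambda\rangle$ and $\langle u,a\cdot\Lambda\rangle=\langle u\cdot a,\Lambda\rangle$ for $\Lambda\in\mathcal{A}^{(k)}$, $u\in\mathcal{A}^{(k-1)}$, $a\in\mathcal{A}$. A derivation $D:\mathcal{A}\to\mathcal{X}$ into a Banach $\mathcal{A}$-bimodule is a linear map with $D(ab)=a\cdot D(b)+D(a)\cdot b$. It is approximately inner if there is a net $(x_\alpha)\subseteq\mathcal{X}$ (not required to be bounded) with $D(a)=\lim_\alpha(a\cdot x_\alpha-x_\alpha\cdot a)$ in norm for every $a\in\mathcal{A}$. $\mathcal{A}$ is approximately $k$-weakly amenable if every continuous derivation $\mathcal{A}\to\mathcal{A}^{(k)}$ is approximately inner. *)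

(* Defs.v *)
From HB Require Import structures.
From mathcomp Require Import all_boot all_order all_algebra.
From mathcomp Require Import all_classical all_reals all_analysis.
From mathcomp Require Import complex.

Set Implicit Arguments.
Unset Strict Implicit.
Unset Printing Implicit Defensive.

Import Order.TTheory GRing.Theory Num.Theory.
Import numFieldNormedType.Exports.

Local Open Scope classical_set_scope.
Local Open Scope ring_scope.

(* The scalar fields of the theory are R and C. Both are instances of a
   numFieldType in which the nonnegative elements have suprema
   (sup_complete_real and sup_complete_complex below); by Gelfand-Mazur they
   are, up to isomorphism, the only ones. *)
Definition sup_complete (K : numFieldType) : Prop :=
  forall E : set K, E !=set0 -> E `<=` [set x | 0 <= x] -> has_ubound E ->
  exists s, isLub E s.

Lemma sup_complete_real (R : realType) : sup_complete R.
Proof.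
move=> E E0 _ Eub; exists (sup E); split; first exact/ubP/sup_upper_bound.
by move=> b /ge_sup; apply.
Qed.

Lemma sup_complete_complex (R : realType) : sup_complete R[i].
Proof.
move=> E [x0 Ex0] Ege0 [m Em].
have reE z : E z -> z = ((complex.Re z)%:C)%C.
  by move=> /Ege0; case: z => a b; rewrite /= lecE /= => /andP[/eqP-> _].
pose F := [set complex.Re z | z in E].
have hF : has_sup F.
  split; first by exists (complex.Re x0), x0.
  exists (complex.Re m) => _ [z Ez <-].
  by have := Em _ Ez; rewrite lecE => /andP[].
exists (sup F)%:C%C; split=> [z Ez|b Eb].
  rewrite (reE _ Ez) lecR; apply: sup_upper_bound => //.
  by exists z.
have := Eb _ Ex0; rewrite (reE _ Ex0) lecE /= => /andP[/eqP b0 _].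
rewrite lecE /= b0 eqxx /=; apply: ge_sup; first by case: hF.
by move=> _ [z Ez <-]; have := Eb _ Ez; rewrite lecE => /andP[].
Qed.

(* Banach algebras are not assumed to have a unit, so they are not built on
   MathComp's (unital) algebra structures. *)
HB.mixin Record isBanachAlgebra (K : numFieldType) A
    & CompleteNormedModule K A := {
  bmul : A -> A -> A;
  bmulA : associative bmul;
  bmul_linearl : forall b, linear (bmul^~ b);
  bmul_linearr : forall a, linear (bmul a);
  ler_norm_bmul : forall a b, `|bmul a b| <= `|a| * `|b|
}.

#[short(type="banachAlgType")]
HB.structure Definition BanachAlgebra (K : numFieldType) :=
  {A of CompleteNormedModule K A & isBanachAlgebra K A}.

(* Completeness of the bimodule is not required: it plays no role in the
   notions of derivation and of approximate innerness. *)
HB.mixin Record isNormedBimodule (K : numFieldType) (A : banachAlgType K) X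
    & NormedModule K X := {
  lact : A -> X -> X;
  ract : X -> A -> X;
  lact_linearl : forall x, linear (lact^~ x);
  lact_linearr : forall a, linear (lact a);
  ract_linearl : forall a, linear (ract^~ a);
  ract_linearr : forall x, linear (ract x);
  lactM : forall a b x, lact (bmul a b) x = lact a (lact b x);
  ractM : forall a b x, ract x (bmul a b) = ract (ract x a) b;
  lract : forall a b x, ract (lact a x) b = lact a (ract x b);
  lact_bounded : exists M : K, forall a x, `|lact a x| <= M * `|a| * `|x|;
  ract_bounded : exists M : K, forall a x, `|ract x a| <= M * `|a| * `|x|
}.

#[short(type="normedBimodType")]
HB.structure Definition NormedBimodule (K : numFieldType)
    (A : banachAlgType K) :=
  {X of NormedModule K X & isNormedBimodule K A X}.

(* A as a bimodule over itself. *)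
Section Regular.
Context (K : numFieldType) (A : banachAlgType K).

Let bmul_bounded : exists M : K, forall a x : A, `|bmul a x| <= M * `|a| * `|x|.
Proof. by exists 1 => a x; rewrite mul1r ler_norm_bmul. Qed.

Let bmul_boundedr :
  exists M : K, forall a x : A, `|bmul x a| <= M * `|a| * `|x|.
Proof. by exists 1 => a x; rewrite mul1r mulrC ler_norm_bmul. Qed.

Definition regular_bimod : Type := A.

HB.instance Definition _ := NormedModule.on regular_bimod.

HB.instance Definition _ := isNormedBimodule.Build K A regular_bimod
  bmul_linearl bmul_linearr bmul_linearl bmul_linearr
  (fun a b x => esym (bmulA a b x)) (fun a b x => bmulA x a b)
  (fun a b x => esym (bmulA a x b)) bmul_bounded bmul_boundedr.

End Regular.

(* The dual of a normed space V: continuous linear functionals with the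
   operator norm sup { |f x| : |x| <= 1 }. The parameter hK is only used to
   prove that this norm is a norm. *)
Section DualSpace.
Context (K : numFieldType) (V : normedModType K).

Definition dual_pred : {pred V -> K^o} :=
  mem [set f : V -> K^o | linear f /\ continuous f].

Record dual (hK : sup_complete K) := Dual {
  dual_fun :> V -> K^o;
  dual_funP : dual_fun \in dual_pred
}.

Lemma dual_submod_closed : submod_closed dual_pred.
Proof.
split.
  rewrite inE; split; first by move=> a x y; rewrite scaler0 addr0.
  exact: cst_continuous.
move=> a f g; rewrite !inE => -[fl fc] [gl gc]; split.
  move=> b x y; rewrite !fctE fl gl.
  by rewrite !scalerDr !scalerA (mulrC a b) addrACA.
move=> x; apply: cvgD; last exact: gc.
by apply: cvgZr; exact: fc.
Qed.

HB.instance Definition _ :=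
  GRing.isSubmodClosed.Build K (V -> K^o) dual_pred dual_submod_closed.

Context (hK : sup_complete K).

HB.instance Definition _ := [isSub for @dual_fun hK].
HB.instance Definition _ := [Choice of dual hK by <:].
HB.instance Definition _ := [SubChoice_isSubLmodule of dual hK by <:].

Lemma dual_linear (f : dual hK) : linear f.
Proof. by have := dual_funP f; rewrite inE => -[]. Qed.

Lemma dual_continuous (f : dual hK) : continuous f.
Proof. by have := dual_funP f; rewrite inE => -[]. Qed.

HB.instance Definition _ (f : dual hK) :=
  GRing.isLinear.Build K V K^o _ f (dual_linear f).

Lemma dualP (f g : dual hK) : (forall x, f x = g x) -> f = g.
Proof. by move=> fg; apply: val_inj; apply/funext. Qed.

Definition dual_norm (f : dual hK) : K :=
  supremum 0 [set `|f x| | x in [set x | `|x| <= 1]].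

Let dual_normP (f : dual hK) :
  isLub [set `|f x| | x in [set x | `|x| <= 1]] (dual_norm f).
Proof.
set E := [set _ | _ in _].
have E0 : E !=set0 by exists `|f 0|, 0 => //=; rewrite normr0.
have [s Es] : exists s, isLub E s.
  apply: hK => //; first by move=> _ [x _ <-] /=.
  have /linear_bounded_continuous/linear_boundedP := @dual_continuous f.
  case/pinfty_ex_gt0 => r r0 fr; exists r => _ [x /= x1 <-].
  by apply: le_trans (fr x) _; rewrite ler_piMr// ltW.
rewrite /dual_norm /supremum ifF; last by apply/negbTE/set0P.
by case: xgetP => [y _ //|/(_ s)]; case.
Qed.

Lemma dual_norm_ge0 (f : dual hK) : 0 <= dual_norm f.
Proof.
have [ub _] := dual_normP f; apply: le_trans (normr_ge0 (f 0)) _.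
by apply: ub; exists 0 => //=; rewrite normr0.
Qed.

Lemma ler_dual_norm (f : dual hK) x : `|f x| <= dual_norm f * `|x|.
Proof.
have [->|x0] := eqVneq x 0; first by rewrite linear0 !normr0 mulr0.
have nx0 : 0 < `|x| by rewrite normr_gt0.
have [ub _] := dual_normP f.
rewrite -ler_pdivrMr//; apply: ub; exists (`|x|^-1 *: x) => /=.
  by rewrite normrZ ger0_norm ?invr_ge0// mulVf ?lt0r_neq0.
by rewrite linearZ/= normrZ ger0_norm ?invr_ge0// mulrC.
Qed.

Lemma dual_norm_le (f : dual hK) M :
  0 <= M -> (forall x, `|f x| <= M * `|x|) -> dual_norm f <= M.
Proof.
move=> M0 fM; have [_ lb] := dual_normP f; apply: lb => _ [x /= x1 <-].
by apply: le_trans (fM x) _; rewrite ler_piMr.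
Qed.

Let dual_normD f g : dual_norm (f + g) <= dual_norm f + dual_norm g.
Proof.
apply: dual_norm_le => [|x]; first by rewrite addr_ge0 ?dual_norm_ge0.
by rewrite mulrDl (le_trans (ler_normD _ _))// lerD ?ler_dual_norm.
Qed.

Let dual_normZ_le (l : K) (f : dual hK) :
  dual_norm (l *: f) <= `|l| * dual_norm f.
Proof.
apply: dual_norm_le => [|x]; first by rewrite mulr_ge0 ?dual_norm_ge0.
by rewrite -mulrA -[(l *: f) x]/(l * f x) normrM ler_wpM2l ?ler_dual_norm.
Qed.

Let dual_normZ (l : K) (f : dual hK) : dual_norm (l *: f) = `|l| * dual_norm f.
Proof.
apply/eqP; rewrite eq_le dual_normZ_le /=.
have [->|l0] := eqVneq l 0; first by rewrite normr0 mul0r dual_norm_ge0.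
rewrite -ler_pdivlMl ?normr_gt0// -normfV.
by have := dual_normZ_le l^-1 (l *: f); rewrite scalerA mulVf// scale1r.
Qed.

Let dual_norm0_eq0 (f : dual hK) : dual_norm f = 0 -> f = 0.
Proof.
move=> f0; apply: dualP => x; apply/eqP; rewrite -normr_le0.
by have := ler_dual_norm f x; rewrite f0 mul0r.
Qed.

HB.instance Definition _ := Lmodule_isNormed.Build K (dual hK)
  dual_normD dual_normZ dual_norm0_eq0.

End DualSpace.

(* The dual of an A-bimodule: <u, L . a> = <a . u, L> and
   <u, a . L> = <u . a, L>. *)
Section DualBimodule.
Context (K : numFieldType) (hK : sup_complete K) (A : banachAlgType K).
Context (X : normedBimodType A).

Let comp_dual (f : dual X hK) (T : X -> X) (M : K) :
  linear T -> (forall u, `|T u| <= M * `|u|) ->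
  (fun u => f (T u)) \in dual_pred (V := X).
Proof.
move=> Tl TM.
have fTl : linear (fun u => f (T u)) by move=> a u v; rewrite Tl linearP.
rewrite inE; split=> //.
pose L := GRing.isLinear.Build K X K^o _ _ fTl.
pose g : {linear X -> K^o} := HB.pack (fun u => f (T u)) L.
apply: (@bounded_linear_continuous _ _ _ g); apply/linear_boundedP.
exists (dual_norm f * `|M|); split=> [|r Mr u].
  by rewrite ger0_real// mulr_ge0 ?dual_norm_ge0.
apply: le_trans (ler_dual_norm f (T u)) _.
apply: (@le_trans _ _ (dual_norm f * `|M| * `|u|)); last first.
  by rewrite ler_wpM2r// ltW.
rewrite -mulrA ler_wpM2l ?dual_norm_ge0//.
rewrite -[`|u|]normr_id -normrM ger0_norm//.
exact: le_trans (normr_ge0 _) (TM u).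
Qed.

Let dual_ract_subproof (f : dual X hK) (a : A) :
  (fun u => f (lact a u)) \in dual_pred (V := X).
Proof.
have [M /(_ a) lM] := @lact_bounded K A X.
exact: comp_dual (lact_linearr a) lM.
Qed.

Let dual_lact_subproof (a : A) (f : dual X hK) :
  (fun u => f (ract u a)) \in dual_pred (V := X).
Proof.
have [M /(_ a) rM] := @ract_bounded K A X.
exact: comp_dual (ract_linearl a) rM.
Qed.

Definition dual_ract (f : dual X hK) (a : A) : dual X hK :=
  Dual hK (dual_ract_subproof f a).

Definition dual_lact (a : A) (f : dual X hK) : dual X hK :=
  Dual hK (dual_lact_subproof a f).

Let dual_lact_linearl (f : dual X hK) : linear (dual_lact^~ f).
Proof.
move=> k a b; apply: dualP => u.
by rewrite /= ract_linearr linearP.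
Qed.

Let dual_lact_linearr (a : A) : linear (dual_lact a).
Proof. by move=> k f g; apply: dualP. Qed.

Let dual_ract_linearl (a : A) : linear (dual_ract^~ a).
Proof. by move=> k f g; apply: dualP. Qed.

Let dual_ract_linearr (f : dual X hK) : linear (dual_ract f).
Proof.
move=> k a b; apply: dualP => u.
by rewrite /= lact_linearl linearP.
Qed.

Let dual_lactM (a b : A) (f : dual X hK) :
  dual_lact (bmul a b) f = dual_lact a (dual_lact b f).
Proof. by apply: dualP => u /=; rewrite ractM. Qed.

Let dual_ractM (a b : A) (f : dual X hK) :
  dual_ract f (bmul a b) = dual_ract (dual_ract f a) b.
Proof. by apply: dualP => u /=; rewrite lactM. Qed.

Let dual_lract (a b : A) (f : dual X hK) :
  dual_ract (dual_lact a f) b = dual_lact a (dual_ract f b).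
Proof. by apply: dualP => u /=; rewrite lract. Qed.

Let dual_act_bounded (T : A -> X -> X) (S : A -> dual X hK -> dual X hK) :
  (forall a f u, S a f u = f (T a u)) ->
  (exists M : K, forall a x, `|T a x| <= M * `|a| * `|x|) ->
  exists M : K, forall a f, `|S a f| <= M * `|a| * `|f|.
Proof.
move=> ST [M TM]; exists `|M| => a f.
apply: dual_norm_le => [|u]; first by rewrite !mulr_ge0.
rewrite ST; apply: le_trans (ler_dual_norm f _) _.
rewrite -[dual_norm f]/(`|f|) [X in X * `|u|]mulrC -mulrA ler_wpM2l//.
rewrite -[`|a|]normr_id -[`|u|]normr_id -!normrM ger0_norm//.
exact: le_trans (normr_ge0 _) (TM a u).
Qed.

Let dual_lact_bounded :
  exists M : K, forall a f, `|dual_lact a f| <= M * `|a| * `|f|.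
Proof.
by apply: (@dual_act_bounded (fun a u => ract u a)) => //; exact: ract_bounded.
Qed.

Let dual_ract_bounded :
  exists M : K, forall a f, `|dual_ract f a| <= M * `|a| * `|f|.
Proof.
apply: (@dual_act_bounded lact (fun a f => dual_ract f a)) => //.
exact: lact_bounded.
Qed.

HB.instance Definition _ := isNormedBimodule.Build K A (dual X hK)
  dual_lact_linearl dual_lact_linearr dual_ract_linearl dual_ract_linearr
  dual_lactM dual_ractM dual_lract
  dual_lact_bounded dual_ract_bounded.

End DualBimodule.

Fixpoint iter_dual (K : numFieldType) (hK : sup_complete K)
    (A : banachAlgType K) (k : nat) : normedBimodType A :=
  if k is k'.+1 then dual (iter_dual hK A k') hK : normedBimodType A
  else regular_bimod A.

Section Amenability.
Context (K : numFieldType) (A : banachAlgType K).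

Definition derivation (X : normedBimodType A) (D : {linear A -> X}) : Prop :=
  forall a b, D (bmul a b) = lact a (D b) + ract (D a) b.

Definition directed (I : Type) (le : I -> I -> Prop) : Prop :=
  [/\ inhabited I, forall i, le i i,
      forall i j k, le i j -> le j k -> le i k &
      forall i j, exists k, le i k /\ le j k].

(* Convergence of the net x along (I, le) is convergence of x @ net_tails le. *)
Definition net_tails (I : Type) (le : I -> I -> Prop) : set_system I :=
  [set E | exists i0, forall i, le i0 i -> E i].

Definition approx_inner (X : normedBimodType A) (D : A -> X) : Prop :=
  exists (I : Type) (le : I -> I -> Prop) (x : I -> X),
    directed le /\
    forall a, (fun i => lact a (x i) - ract (x i) a) @ net_tails le --> D a.

Definition approx_weakly_amenable (hK : sup_complete K) (k : nat) : Prop :=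
  forall D : {linear A -> iter_dual hK A k},
    continuous D -> derivation D -> approx_inner D.

End Amenability.

(* Main.v *)
Require Import Defs.
From HB Require Import structures.
From mathcomp Require Import all_boot all_order all_algebra.
From mathcomp Require Import all_classical all_reals all_analysis.

(** Write [A^(n) = X*] with [X = A^(n-1)]. The canonical embedding [J] of [X*]
    into [X***] and the transpose [P] of the canonical embedding of [X] into
    [X**] are bounded bimodule maps, and [P \o J = id]. If [D] is a continuous
    derivation into [X*], then so is [J \o D] into [X***]; applying [P] to a net
    implementing [J \o D] yields a net implementing [P \o J \o D = D]. *)

Set Implicit Arguments.
Unset Strict Implicit.
Unset Printing Implicit Defensive.

Import Order.TTheory GRing.Theory Num.Theory.
Import numFieldNormedType.Exports.

Local Open Scope classical_set_scope.
Local Open Scope ring_scope.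

Lemma bounded_linear_fun_continuous (K : numFieldType) (V W : normedModType K)
    (f : V -> W) (M : K) :
  linear f -> (forall x, `|f x| <= M * `|x|) -> continuous f.
Proof.
move=> fl fM.
pose g : {linear V -> W} := HB.pack f (GRing.isLinear.Build K V W _ _ fl).
apply: (@bounded_linear_continuous _ _ _ g); apply/linear_boundedP.
(* [M] may fail to be nonnegative, or even real, when [V] is trivial. Otherwise [M * |u|] dominates
   a norm, so it equals its own norm [|M| * |u|]. *)
exists `|M|; split=> [|r Mr u]; first exact: normr_real.
apply: (@le_trans _ _ (`|M| * `|u|)); last by rewrite ler_wpM2r// ltW.
rewrite -[`|u|]normr_id -normrM ger0_norm//.
exact: le_trans (normr_ge0 _) (fM u).
Qed.

Section DualMaps.
Context (K : numFieldType) (hK : sup_complete K).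

Lemma bounded_linear_dual_pred (V : normedModType K) (f : V -> K^o) (M : K) :
  linear f -> (forall x, `|f x| <= M * `|x|) -> f \in dual_pred (V := V).
Proof.
by move=> fl fM; rewrite inE; split=> //;
  exact: bounded_linear_fun_continuous fM.
Qed.

Section Bidual.
Context (V : normedModType K).

Lemma dual_eval_subproof (x : V) :
  (fun f : dual V hK => f x : K^o) \in dual_pred (V := dual V hK).
Proof.
apply: (bounded_linear_dual_pred (M := `|x|)) => // f.
by rewrite mulrC; exact: ler_dual_norm.
Qed.

(** The canonical embedding into the bidual. It is used at two levels: at [X] to build the map P,
    and at the dual of [X] as the map J. *)
Definition dual_eval (x : V) : dual (dual V hK) hK :=
  Dual hK (dual_eval_subproof x).

Lemma dual_eval_linear : linear dual_eval.
Proof. by move=> k x y; apply: dualP => f /=; rewrite linearP. Qed.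

HB.instance Definition _ :=
  GRing.isLinear.Build K V (dual (dual V hK) hK) _ dual_eval dual_eval_linear.

(** This is [ler_dual_norm] read as a bound in [f] for fixed [x]. The factor 1 gives it the shape
    that [bounded_linear_fun_continuous] expects. *)
Lemma ler_norm_dual_eval (x : V) : `|dual_eval x| <= 1 * `|x|.
Proof.
rewrite mul1r; apply: dual_norm_le => // f.
by rewrite [leRHS]mulrC; exact: ler_dual_norm f x.
Qed.

Lemma dual_eval_continuous : continuous dual_eval.
Proof.
exact: bounded_linear_fun_continuous dual_eval_linear ler_norm_dual_eval.
Qed.

End Bidual.

Section Restriction.
Context (V : normedModType K).

Lemma dual_restrict_bound (L : dual (dual (dual V hK) hK) hK) (x : V) :
  `|L (dual_eval x)| <= `|L| * `|x|.
Proof.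
apply: le_trans (ler_dual_norm L _) _; rewrite ler_wpM2l ?dual_norm_ge0//.
by rewrite -[leRHS]mul1r ler_norm_dual_eval.
Qed.

Lemma dual_restrict_subproof (L : dual (dual (dual V hK) hK) hK) :
  (fun x => L (dual_eval x)) \in dual_pred (V := V).
Proof.
apply: bounded_linear_dual_pred (dual_restrict_bound L).
by move=> k x y; rewrite !linearP.
Qed.

(** The transpose P of the embedding of [V] into its bidual. *)
Definition dual_restrict (L : dual (dual (dual V hK) hK) hK) : dual V hK :=
  Dual hK (dual_restrict_subproof L).

Lemma dual_restrict_linear : linear dual_restrict.
Proof. by move=> k L L'; apply: dualP. Qed.

HB.instance Definition _ :=
  GRing.isLinear.Build K (dual (dual (dual V hK) hK) hK) (dual V hK) _
    dual_restrict dual_restrict_linear.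

Lemma dual_restrict_continuous : continuous dual_restrict.
Proof.
apply: (bounded_linear_fun_continuous (M := 1) dual_restrict_linear) => L.
by rewrite mul1r; apply: dual_norm_le => // x; exact: dual_restrict_bound.
Qed.

(** At [x], the left side is evaluation at [f] applied to evaluation at [x], which unfolds to
    [f x]. *)
Lemma dual_evalK : cancel (@dual_eval (dual V hK)) dual_restrict.
Proof. by move=> f; apply: dualP. Qed.

End Restriction.

Section Bimodule.
Context (A : banachAlgType K) (X : normedBimodType A).

(** Each dualization swaps the two actions, so the bidual restores their sides: both functionals
    send [f] to [f (lact a x)]. *)
Lemma dual_eval_lact (a : A) (x : X) :
  dual_eval (lact a x) = lact a (dual_eval x).
Proof. exact: dualP. Qed.

Lemma dual_eval_ract (a : A) (x : X) :
  dual_eval (ract x a) = ract (dual_eval x) a.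
Proof. exact: dualP. Qed.

(** Transposing swaps sides: compatibility with the left action comes from that of [dual_eval] with
    the right one. *)
Lemma dual_restrict_lact (a : A) (L : dual (dual (dual X hK) hK) hK) :
  dual_restrict (lact a L) = lact a (dual_restrict L).
Proof. by apply: dualP => x /=; rewrite dual_eval_ract. Qed.

Lemma dual_restrict_ract (a : A) (L : dual (dual (dual X hK) hK) hK) :
  dual_restrict (ract L a) = ract (dual_restrict L) a.
Proof. by apply: dualP => x /=; rewrite dual_eval_lact. Qed.

End Bimodule.

End DualMaps.

Lemma net_tails_filter (I : Type) (le : I -> I -> Prop) :
  directed le -> Filter (net_tails le).
Proof.
move=> [[i0] _ letr ledir]; split; first by exists i0.
- move=> P Q [i Pi] [j Qj]; have [k [ik jk]] := ledir i j.
  by exists k => l kl; split; [apply: Pi|apply: Qj]; apply: letr kl.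
- by move=> P Q PQ [i Pi]; exists i => j /Pi /PQ.
Qed.

Section BimoduleMaps.
Context (K : numFieldType) (A : banachAlgType K) (X Y : normedBimodType A).
Context (T : {linear X -> Y}).
Hypothesis T_lact : forall a x, T (lact a x) = lact a (T x).
Hypothesis T_ract : forall a x, T (ract x a) = ract (T x) a.

Lemma derivation_comp (D : {linear A -> X}) :
  derivation D -> derivation (T \o D : {linear A -> Y}).
Proof. by move=> Dder a b /=; rewrite Dder linearD T_lact T_ract. Qed.

(** The image net [T \o x], over the same index set, works: [T] carries the inner derivation of
    [x i] to that of [T (x i)], and continuity preserves the limit. *)
Lemma approx_inner_comp (D : A -> X) :
  continuous T -> approx_inner D -> approx_inner (T \o D).
Proof.
move=> Tc [I [le [x [dir xD]]]]; exists I, le, (T \o x); split=> // a.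
have Ff := net_tails_filter dir.
under eq_fun do rewrite /= -T_lact -T_ract -raddfB.
by apply: (cvg_comp _ _ (xD a)); exact: Tc.
Qed.

End BimoduleMaps.

(** The descent for the dual of an arbitrary bimodule. For n >= 1 the theorem is the instance X =
    A^(n-1), where A^(n) and A^(n+2) unfold to X* and X***. *)
Lemma dual_approx_inner (K : numFieldType) (hK : sup_complete K)
    (A : banachAlgType K) (X : normedBimodType A) :
  (forall D : {linear A -> dual (dual (dual X hK) hK) hK},
     continuous D -> derivation D -> approx_inner D) ->
  forall D : {linear A -> dual X hK},
    continuous D -> derivation D -> approx_inner D.
Proof.
move=> wa D Dc Dder.
pose J : {linear dual X hK -> _} := @dual_eval K hK (dual X hK).
pose P : {linear _ -> dual X hK} := @dual_restrict K hK X.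
have JDc : continuous (J \o D).
  by move=> a; apply: continuous_comp; [exact: Dc|exact: dual_eval_continuous].
have JDder : derivation (J \o D : {linear A -> _}).
  by apply: derivation_comp => // a f; [exact: dual_eval_lact|exact: dual_eval_ract].
have /(approx_inner_comp (T := P)) := wa _ JDc JDder.
have -> : P \o (J \o D) = D by apply/funext => a; exact: dual_evalK.
apply; [exact: dual_restrict_lact|exact: dual_restrict_ract|].
exact: dual_restrict_continuous.
Qed.

Theorem theorem3p1 (K : numFieldType) (hK : sup_complete K)
    (A : banachAlgType K) (n : nat) (hn : (1 <= n)%N) :
  approx_weakly_amenable A hK n.+2 -> approx_weakly_amenable A hK n.
Proof. by case: n hn => // n _; exact: dual_approx_inner. Qed.
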